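(* Let $(X,Y)$ be a pair of random variables on finite sets $\mathcal{X}\times\mathcal{Y}$ inducing a pair of stationary memoryless sources, let $\hat{\mathcal{X}}$ be a finite set, and let $c:\mathcal{X}\times\hat{\mathcal{X}}\to[0,\infty)$ be an arbitrary function inducing the additive cost $c_n(x^n,\hat x^n)=\frac1n\sum_{i=1}^nc(x_i,\hat x_i)$. For any $\epsilon\ge0$, the minimum average cost under the strong independence criterion satisfies $$C_{\rm a}^{*}(\epsilon)=\min_{\substack{\hat X:\ Y-X-\hat X,\\ I(Y;\hat X)=0}}\mathrm{E}[c(X,\hat X)],$$ where the minimum is over all random variables $\hat X$ on $\hat{\mathcal{X}}$, jointly distributed with $(X,Y)$, such that $Y-X-\hat X$ is a Markov chain and $I(Y;\hat X)=0$.
   Context: $\mathcal{X},\mathcal{Y},\hat{\mathcal{X}}$ are finite nonempty sets; $I(\cdot;\cdot)$ is mutual information (natural logarithm). The stationary memoryless sources induced by $(X,Y)$: $(X_1,Y_1),(X_2,Y_2),\dots$ are independent copies of $(X,Y)$, and $X^n=(X_1,\dots,X_n)$, $Y^n=(Y_1,\dots,Y_n)$. A stochastic encoder $f_n:\mathcal{X}^n\to\hat{\mathcal{X}}^n$ is a random map, i.e. given by a conditional probability distribution on $\hat{\mathcal{X}}^n$ given $x^n\in\mathcal{X}^n$; its output $f_n(X^n)$ depends on $(X^n,Y^n)$ only through $X^n$, so $Y^n-X^n-f_n(X^n)$ is a Markov chain. For reals $\Gamma,\epsilon\ge0$, $\Gamma$ is $\epsilon$-strongly achievable in the sense of the average cost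 if there exists a sequence of stochastic encoders $\{f_n\}_{n=1}^\infty$ with $\limsup_{n\to\infty}I(Y^n;f_n(X^n))\le\epsilon$ (mutual information not normalized by $n$) and $\limsup_{n\to\infty}\mathrm{E}[c_n(X^n,f_n(X^n))]\le\Gamma$. Define $C_{\rm a}^*(\epsilon)=\inf\{\Gamma\ge 0:\Gamma\text{ is }\epsilon\text{-strongly achievable in the sense of the average cost}\}$. *)

(* Defs.v *)
From HB Require Import structures.
From mathcomp Require Import all_boot all_order all_algebra.
From mathcomp Require Import all_classical all_reals all_analysis.

Set Implicit Arguments.
Unset Strict Implicit.
Unset Printing Implicit Defensive.

Import Order.TTheory GRing.Theory Num.Theory.

Local Open Scope classical_set_scope.
Local Open Scope ring_scope.

Record fdist (R : realType) (A : finType) := FDist {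
  fdist_fun :> A -> R;
  fdist_ge0 : forall a, 0 <= fdist_fun a;
  fdist_sum1 : \sum_a fdist_fun a = 1 }.

Section FiniteProbabilitySpace.
Variables (R : realType) (W : finType) (P : fdist R W).

Definition expect (f : W -> R) : R := \sum_w P w * f w.

Definition law (A : finType) (U : W -> A) (a : A) : R :=
  \sum_(w | U w == a) P w.

(* Terms with joint mass 0 vanish, so the convention 0 * ln 0 = 0 holds; a
   positive joint mass forces both marginals to be positive. *)
Definition mutual_info (A B : finType) (U : W -> A) (V : W -> B) : R :=
  \sum_a \sum_b
    law (fun w => (U w, V w)) (a, b) *
    ln (law (fun w => (U w, V w)) (a, b) / (law U a * law V b)).

(* Conditional independence of U and Z given V, with denominators cleared so
   that nothing is asked at values of V of probability 0. *)
Definition markov_chain (A B C : finType)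
    (U : W -> A) (V : W -> B) (Z : W -> C) : Prop :=
  forall a b c,
    law (fun w => (U w, V w, Z w)) (a, b, c) * law V b =
    law (fun w => (U w, V w)) (a, b) * law (fun w => (V w, Z w)) (b, c).

End FiniteProbabilitySpace.

Lemma iid_ge0 (R : realType) (A : finType) (P : fdist R A) n
  (w : {ffun 'I_n -> A}) : 0 <= \prod_i P (w i).
Proof. by apply: prodr_ge0 => i _; exact: fdist_ge0. Qed.

Lemma iid_sum1 (R : realType) (A : finType) (P : fdist R A) n :
  \sum_(w : {ffun 'I_n -> A}) \prod_i P (w i) = 1.
Proof.
rewrite -(bigA_distr_bigA (fun (_ : 'I_n) a => P a)) big1 // => i _.
exact: fdist_sum1.
Qed.

Definition iid (R : realType) (A : finType) (P : fdist R A) (n : nat) :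
    fdist R {ffun 'I_n -> A} :=
  FDist (iid_ge0 P (n := n)) (iid_sum1 P n).

Lemma joint_ge0 (R : realType) (A B : finType) (P : fdist R A)
  (K : A -> fdist R B) (ab : A * B) : 0 <= P ab.1 * K ab.1 ab.2.
Proof. by apply: mulr_ge0; exact: fdist_ge0. Qed.

Lemma joint_sum1 (R : realType) (A B : finType) (P : fdist R A)
  (K : A -> fdist R B) : \sum_(ab : A * B) P ab.1 * K ab.1 ab.2 = 1.
Proof.
rewrite -(pair_bigA _ (fun a b => P a * K a b)) /= -[RHS](fdist_sum1 P).
by apply: eq_bigr => a _; rewrite -big_distrr /= fdist_sum1 mulr1.
Qed.

Definition joint (R : realType) (A B : finType) (P : fdist R A)
    (K : A -> fdist R B) : fdist R (A * B)%type :=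
  FDist (joint_ge0 P K) (joint_sum1 P K).

Section StrongIndependence.
Variables (R : realType) (X Y Xh : finType).

Definition encoder (n : nat) : Type :=
  {ffun 'I_n -> X} -> fdist R {ffun 'I_n -> Xh}.

Definition xseq n (z : {ffun 'I_n -> X * Y}) : {ffun 'I_n -> X} :=
  [ffun i => (z i).1].
Definition yseq n (z : {ffun 'I_n -> X * Y}) : {ffun 'I_n -> Y} :=
  [ffun i => (z i).2].

(* The joint law of ((X^n, Y^n), f_n(X^n)). *)
Definition encoded (P : fdist R (X * Y)%type) n (f : encoder n) :
    fdist R ({ffun 'I_n -> X * Y} * {ffun 'I_n -> Xh})%type :=
  joint (iid P n) (fun z => f (xseq z)).

Definition leakage P n (f : encoder n) : R :=
  mutual_info (encoded P f) (fun w => yseq w.1) (fun w => w.2).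

Definition additive_cost (c : X -> Xh -> R) n
    (x : {ffun 'I_n -> X}) (xh : {ffun 'I_n -> Xh}) : R :=
  n%:R^-1 * \sum_(i < n) c (x i) (xh i).

Definition average_cost P (c : X -> Xh -> R) n (f : encoder n) : R :=
  expect (encoded P f) (fun w => additive_cost c (xseq w.1) w.2).

(* Sequences are indexed from 0, but a limsup ignores the term n = 0.  It is
   taken in \bar R since the unnormalized leakage may be unbounded. *)
Definition strongly_achievable P (c : X -> Xh -> R) (eps G : R) : Prop :=
  exists f : forall n, encoder n,
    (limn_esup (fun n => (leakage P (f n))%:E) <= eps%:E)%E /\
    (limn_esup (fun n => (average_cost P c (f n))%:E) <= G%:E)%E.

Definition min_average_cost P (c : X -> Xh -> R) (eps : R) : \bar R :=
  ereal_inf [set G%:E | G in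
    [set G : R | 0 <= G /\ strongly_achievable P c eps G]].

(* Q is the joint law of (X, Y, Xhat), and P that of (X, Y). *)
Definition independent_reproduction (P : fdist R (X * Y)%type)
    (Q : fdist R (X * Y * Xh)%type) : Prop :=
  [/\ forall xy, law Q (fun w => w.1) xy = P xy,
      markov_chain Q (fun w => w.1.2) (fun w => w.1.1) (fun w => w.2)
    & mutual_info Q (fun w => w.1.2) (fun w => w.2) = 0].

Definition single_letter_costs P (c : X -> Xh -> R) : set R :=
  [set expect Q (fun w => c w.1.1 w.2) | Q in independent_reproduction P].

End StrongIndependence.

Definition is_minimum (R : realType) (S : set R) (m : R) : Prop :=
  S m /\ lbound S m.

(* Main.v *)
(** A kernel from X to Xh making Y and the output independent, used letter by
letter, leaks nothing and has exactly its single-letter cost; this gives the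
upper bound.

For the lower bound, the mutual information between Y^n and f(X^n) is bounded
below, by Gibbs' variational principle, by the expected logarithm of
prod_i (1 + g(Y_i, Xh_i)), where g has mean zero in its first argument and
|g| <= s.  That product has mean one under the product of the marginals, and
ln (1 + x) >= x - 2 x^2, so averaging over i bounds the mean of g under the
time-averaged joint law of (Y_i, Xh_i) by I(Y^n; f(X^n)) / n + 2 s^2.  Bounded
leakage therefore forces the averaged kernel to be asymptotically independent
of Y, at an unchanged average cost.  Compactness of the set of kernels turns
this approximate independence into an exact one, and also shows that the
minimum is attained. *)
Require Import Defs.
From HB Require Import structures.
From mathcomp Require Import all_boot all_order all_algebra.
From mathcomp Require Import ring lra.
From mathcomp Require Import all_classical all_reals all_analysis.
Set Implicit Arguments.
Unset Strict Implicit.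
Unset Printing Implicit Defensive.

Import Order.TTheory GRing.Theory Num.Theory.
Import numFieldNormedType.Exports.
Local Open Scope classical_set_scope.
Local Open Scope ring_scope.

(** * Elementary facts on finite distributions *)

Lemma fdist_ext (R : realType) (A : finType) (p q : fdist R A) : p =1 q -> p = q.
Proof.
case: p q => [p p0 p1] [q q0 q1] /= /funext pq; move: q0 q1; rewrite -pq => q0 q1.
by congr FDist; exact: Prop_irrelevance.
Qed.

Lemma fdist_le1 (R : realType) (A : finType) (p : fdist R A) a : p a <= 1.
Proof.
rewrite -(fdist_sum1 p) (bigD1 a)//= lerDl.
by apply: sumr_ge0 => i _; exact: fdist_ge0.
Qed.

(** * Laws and mutual information *)

Section Laws.
Context {R : realType} {W : finType} (P : fdist R W).

Lemma law_ge0 (A : finType) (U : W -> A) a : 0 <= law P U a.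
Proof. by apply: sumr_ge0 => w _; exact: fdist_ge0. Qed.

Lemma law_expect (A : finType) (U : W -> A) a :
  law P U a = expect P (fun w => (U w == a)%:R).
Proof.
rewrite /law big_mkcond; apply: eq_bigr => w _.
by case: eqP; rewrite ?mulr1 ?mulr0.
Qed.

Lemma expect_law (A : finType) (U : W -> A) (phi : A -> R) :
  expect P (fun w => phi (U w)) = \sum_a law P U a * phi a.
Proof.
rewrite /expect (partition_big U xpredT)//=; apply: eq_bigr => a _.
by rewrite big_distrl/=; apply: eq_bigr => w /eqP->.
Qed.

Lemma law_sum1 (A : finType) (U : W -> A) : \sum_a law P U a = 1.
Proof.
have := expect_law U (fun=> 1); rewrite /expect.
by under eq_bigr do rewrite mulr1; under [in RHS]eq_bigr do rewrite mulr1;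
  rewrite fdist_sum1.
Qed.

Lemma law_comp (A B : finType) (U : W -> A) (h : A -> B) b :
  law P (fun w => h (U w)) b = \sum_(a | h a == b) law P U a.
Proof.
rewrite {1}/law (partition_big U (fun a => h a == b))//=.
apply: eq_bigr => a /eqP hab; apply: eq_bigl => w.
by case: (U w =P a) => [->|]; rewrite ?andbF// hab eqxx.
Qed.

Lemma law_inj (A B : finType) (U : W -> A) (h : A -> B) a :
  injective h -> law P (fun w => h (U w)) (h a) = law P U a.
Proof. by move=> hi; apply: eq_bigl => w; rewrite (inj_eq hi). Qed.

Lemma law_pairl (A B : finType) (U : W -> A) (V : W -> B) a b :
  law P (fun w => (U w, V w)) (a, b) <= law P U a.
Proof.
rewrite /law [leRHS](bigID (fun w => V w == b))/= -[leLHS]addr0.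
apply: lerD; last by apply: sumr_ge0 => w _; exact: fdist_ge0.
by under eq_bigl do rewrite xpair_eqE.
Qed.

Lemma law_pairr (A B : finType) (U : W -> A) (V : W -> B) a b :
  law P (fun w => (U w, V w)) (a, b) <= law P V b.
Proof.
rewrite /law [leRHS](bigID (fun w => U w == a))/= -[leLHS]addr0.
apply: lerD; last by apply: sumr_ge0 => w _; exact: fdist_ge0.
by under eq_bigl do rewrite xpair_eqE andbC.
Qed.

Lemma expect_pair (A B : finType) (U : W -> A) (V : W -> B) (phi : A -> B -> R) :
  expect P (fun w => phi (U w) (V w)) =
  \sum_a \sum_b law P (fun w => (U w, V w)) (a, b) * phi a b.
Proof.
rewrite (expect_law (fun w => (U w, V w)) (fun ab => phi ab.1 ab.2)).
by rewrite [RHS]pair_bigA; apply: eq_bigr => -[].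
Qed.

Section Information.
Context {A B : finType} (U : W -> A) (V : W -> B).

(** Termwise from [ln x <= x - 1] at [x = r a b / (p / (qa * qb))], scaled by the joint mass [p].
    The mean of [r] enters linearly rather than under a logarithm; this is enough for densities of
    mean one. *)
Lemma gibbs_variational (r : A -> B -> R) : (forall a b, 0 < r a b) ->
  expect P (fun w => ln (r (U w) (V w))) <=
  mutual_info P U V + (\sum_a \sum_b law P U a * law P V b * r a b - 1).
Proof.
move=> r0; rewrite (expect_pair U V (fun a b => ln (r a b))).
(* The constant 1 is spread out as joint mass, so that the two sides compare cell by cell. *)
have -> : 1 = \sum_a \sum_b law P (fun w => (U w, V w)) (a, b).
  by rewrite pair_bigA -(law_sum1 (fun w => (U w, V w))); apply: eq_bigr => -[].
rewrite -sumrB -big_split/=; apply: ler_sum => a _.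
rewrite -sumrB -big_split/=; apply: ler_sum => b _.
have pa := law_pairl U V a b; have pb := law_pairr U V a b.
move: pa pb (law_ge0 U a) (law_ge0 V b) (law_ge0 (fun w => (U w, V w)) (a, b)).
set p := law P _ _; set qa := law P U a; set qb := law P V b => pa pb qa0 qb0.
(* At zero joint mass only the nonnegative term [qa * qb * r a b] survives; otherwise both marginals
   are positive as well. *)
rewrite le_eqVlt => /predU1P[<-|p0].
  by rewrite !mul0r add0r subr0; apply: mulr_ge0 (ltW (r0 a b)); exact: mulr_ge0.
have {}qa0 := lt_le_trans p0 pa; have {}qb0 := lt_le_trans p0 pb.
have rab := r0 a b; rewrite -lerBlDl -mulrBr.
rewrite -ln_div ?posrE ?divr_gt0 ?mulr_gt0//.
have -> : qa * qb * r a b - p = p * (r a b / (p / (qa * qb)) - 1).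
  by field; rewrite !gt_eqF.
rewrite ler_pM2l//.
have x0 : 0 < r a b / (p / (qa * qb)) by rewrite !divr_gt0 ?mulr_gt0.
have := @le_ln1Dx R (r a b / (p / (qa * qb)) - 1).
by rewrite [1 + _]addrC subrK; apply; lra.
Qed.

End Information.
End Laws.

(** * Testing dependence with small perturbations of the product law *)

(** [ln y <= y - 1] at [y = (1 + x)^-1] gives [ln (1 + x) >= x / (1 + x)], which exceeds
    [x - 2 * x ^+ 2] by [x ^+ 2 * (1 + 2 * x) / (1 + x)]; this is nonnegative because
    [x >= - 2^-1]. *)
Lemma ln1D_ge (R : realType) (x : R) : `|x| <= 2^-1 -> x - 2 * x ^+ 2 <= ln (1 + x).
Proof.
rewrite ler_norml => /andP[x1 x2].
have x0 : 0 < 1 + x by lra.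
have := @le_ln1Dx R ((1 + x)^-1 - 1).
rewrite ltrBrDl subrr invr_gt0 => /(_ x0).
rewrite [1 + _]addrC subrK lnV ?posrE// => h.
rewrite -lerN2; apply: le_trans h _.
rewrite -(ler_pM2r x0) mulrBl mulVf ?gt_eqF// mul1r.
have -> : - (x - 2 * x ^+ 2) * (1 + x) = - x + x ^+ 2 * (1 + 2 * x) by ring.
suff : 0 <= x ^+ 2 * (1 + 2 * x) by lra.
by apply: mulr_ge0; [exact: sqr_ge0|lra].
Qed.

(* Gibbs' variational principle with the density prod_i (1 + g i). *)
Lemma expect_le_mutual_info (R : realType) (W A B : finType) (P : fdist R W)
    (U : W -> A) (V : W -> B) n (g : 'I_n -> A -> B -> R) s :
  s <= 2^-1 -> (forall i a b, `|g i a b| <= s) ->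
  (forall b, \sum_a law P U a * \prod_i (1 + g i a b) = 1) ->
  \sum_i expect P (fun w => g i (U w) (V w)) <=
  mutual_info P U V + n%:R * (2 * s ^+ 2).
Proof.
move=> s2 gs g1.
have gp i a b : 0 < 1 + g i a b.
  by have := gs i a b; rewrite ler_norml => /andP[]; lra.
have r0 a b : 0 < \prod_i (1 + g i a b) by apply: prodr_gt0 => i _; exact: gp.
have := gibbs_variational P U V r0.
have -> : \sum_a \sum_b law P U a * law P V b * \prod_i (1 + g i a b) = 1.
  rewrite exchange_big/=; transitivity (\sum_b law P V b); last exact: law_sum1.
  apply: eq_bigr => b _.
  rewrite -[RHS]mulr1 -[in RHS](g1 b) big_distrr/=; apply: eq_bigr => a _.
  by rewrite mulrCA mulrA.
rewrite subrr addr0 -lerBlDr; apply: le_trans.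
have -> : n%:R * (2 * s ^+ 2) = \sum_w P w * (n%:R * (2 * s ^+ 2)).
  by rewrite -big_distrl/= fdist_sum1 mul1r.
rewrite /expect exchange_big/= -sumrB; apply: ler_sum => w _.
rewrite -big_distrr/= -mulrBr; apply: ler_wpM2l; first exact: fdist_ge0.
have -> : ln (\prod_i (1 + g i (U w) (V w))) = \sum_i ln (1 + g i (U w) (V w)).
  (* Positivity of the partial products is carried along with the identity, since [lnM] requires
     it. *)
  suff : 0 < \prod_i (1 + g i (U w) (V w)) /\
     ln (\prod_i (1 + g i (U w) (V w))) = \sum_i ln (1 + g i (U w) (V w)) by case.
  apply: (big_ind2 (fun x y : R => 0 < x /\ ln x = y)).
  - by rewrite ln1.
  - move=> x1 x2 y1 y2 [h1 e1] [h2 e2]; split; first exact: mulr_gt0.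
    by rewrite lnM ?posrE// e1 e2.
  - by move=> i _; split.
have -> : n%:R * (2 * s ^+ 2) = \sum_(i < n) (2 * s ^+ 2).
  by rewrite sumr_const card_ord mulr_natl.
rewrite -sumrB; apply: ler_sum => i _.
have h := gs i (U w) (V w).
apply: le_trans (ln1D_ge (le_trans h s2)).
rewrite lerD2l lerN2 ler_pM2l// -real_normK ?num_real//.
by apply: lerXn2r; rewrite ?nnegrE// (le_trans _ h).
Qed.

(** The indicator of [a0], centred under [p] and localised at [b0]: its expectation measures the
    defect of independence at the cell [(a0, b0)]. The sign of [t] selects a direction; its size is
    tuned against the quadratic error. *)
Definition probe {R : realType} {A B : finType} (p : A -> R) a0 b0 (t : R)
    (a : A) (b : B) : R :=
  t * (((a == a0)%:R - p a0) * (b == b0)%:R).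

Section Probe.
Context {R : realType} {A B : finType} (p : A -> R).
Hypotheses (p0 : forall a, 0 <= p a) (p1 : \sum_a p a = 1).

Lemma probe_le a0 (b0 : B) t a b : `|probe p a0 b0 t a b| <= `|t|.
Proof.
rewrite /probe normrM -[leRHS]mulr1 ler_wpM2l// normrM.
have pa1 : p a0 <= 1.
  by rewrite -p1 (bigD1 a0)//= lerDl; apply: sumr_ge0 => i _; exact: p0.
have := p0 a0; case: (b == b0); last by rewrite normr0 mulr0.
rewrite normr1 mulr1 ler_norml => ?.
by case: (a == a0) => /=; rewrite ?mulr1n ?mulr0n; apply/andP; split; lra.
Qed.

Lemma sum_probe a0 (b0 : B) t b : \sum_a p a * (1 + probe p a0 b0 t a b) = 1.
Proof.
under eq_bigr do rewrite mulrDr mulr1.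
rewrite big_split/= p1 -[RHS]addr0; congr (_ + _).
transitivity (t * (b == b0)%:R * (\sum_a (p a * (a == a0)%:R - p a * p a0))).
  by rewrite big_distrr/=; apply: eq_bigr => a _; rewrite /probe; ring.
rewrite sumrB -big_distrl/= p1 mul1r.
rewrite (bigD1 a0)//= eqxx mulr1 big1 ?addr0 ?subrr ?mulr0//.
by move=> a /negPf->; rewrite mulr0.
Qed.

End Probe.

Lemma expect_probe (R : realType) (W A B : finType) (P : fdist R W)
    (U : W -> A) (V : W -> B) (p : A -> R) a0 b0 t :
  expect P (fun w => probe p a0 b0 t (U w) (V w)) =
  t * (law P (fun w => (U w, V w)) (a0, b0) - p a0 * law P V b0).
Proof.
rewrite !law_expect /expect big_distrr/= -sumrB big_distrr/=.
apply: eq_bigr => w _; rewrite xpair_eqE -mulnb natrM /probe; ring.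
Qed.

(** If the information vanishes, the perturbation bound with a single factor gives
    [t * d <= 2 * t ^+ 2] for all small [t], where [d] is the defect at a cell. Near 0 a linear term
    stays below a quadratic one only if [d = 0]. *)
Lemma mutual_info_eq0P (R : realType) (W A B : finType) (P : fdist R W)
    (U : W -> A) (V : W -> B) :
  mutual_info P U V = 0 <->
  forall a b, law P (fun w => (U w, V w)) (a, b) = law P U a * law P V b.
Proof.
split=> [I0 a0 b0|h]; last first.
  rewrite /mutual_info big1// => a _; rewrite big1// => b _; rewrite h.
  have [->|nz] := eqVneq (law P U a * law P V b) 0; first by rewrite mul0r.
  by rewrite divff// ln1 mulr0.
pose d := law P (fun w => (U w, V w)) (a0, b0) - law P U a0 * law P V b0.
have key t : `|t| <= 2^-1 -> t * d <= 2 * t ^+ 2.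
  move=> t2.
  have g1 b : \sum_a law P U a *
      \prod_(i < 1) (1 + probe (law P U) a0 b0 t a b) = 1.
    under eq_bigr do rewrite big_ord1.
    exact: sum_probe (law_sum1 P U) _ _ _ _.
  have := expect_le_mutual_info (n := 1) V t2
    (fun _ a b => probe_le (law_ge0 P U) (law_sum1 P U) a0 b0 t a b) g1.
  rewrite big_ord1 I0 add0r mul1r real_normK ?num_real//; apply: le_trans.
  by rewrite expect_probe.
apply/eqP; rewrite -subr_eq0 -/d.
(* The test value is [t = k * d]. This [k] keeps [t] small whatever the size of [d], and [k <= 4^-1]
   turns the bound into [d ^+ 2 <= 2^-1 * d ^+ 2]. *)
pose k := (4 * (1 + d ^+ 2))^-1.
have d2 := sqr_ge0 d.
have k0 : 0 < k by rewrite invr_gt0; lra.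
have k1 : k * (1 + d ^+ 2) = 4^-1 by rewrite /k; field; lra.
have := key (k * d).
have -> : k * d * d = k * d ^+ 2 by ring.
have -> : 2 * (k * d) ^+ 2 = k * (2 * k * d ^+ 2) by ring.
rewrite ler_pM2l// normrM (gtr0_norm k0) => /(_ _)h.
rewrite -sqrf_eq0 eq_le d2 andbT.
have {}h : d ^+ 2 <= 2 * k * d ^+ 2.
  apply: h; rewrite -(ler_pM2l (_ : 0 < 1 + d ^+ 2)); last by lra.
  rewrite mulrA [_ * k]mulrC k1 -(real_normK (num_real d)).
  have := sqr_ge0 (`|d| - 1); nra.
have kd : 0 <= k * d ^+ 2 by rewrite mulr_ge0// ltW.
have : 2 * k * d ^+ 2 <= 2^-1 * d ^+ 2 by apply: ler_wpM2r => //; lra.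
lra.
Qed.

(** * Reduction to a single letter *)

Section Products.
Context {R : realType} {I A : finType}.

(** [phi] is absorbed into the factor at [i]; once the product is distributed, every other factor
    sums to 1. *)
Lemma sum_prod_marginal (p : I -> A -> R) i (phi : A -> R) :
  (forall i, \sum_a p i a = 1) ->
  \sum_(w : {ffun I -> A}) \prod_j p j (w j) * phi (w i) = \sum_a p i a * phi a.
Proof.
move=> p1; pose q j a := p j a * (if j == i then phi a else 1).
transitivity (\sum_(w : {ffun I -> A}) \prod_j q j (w j)).
  apply: eq_bigr => w _; rewrite big_split/=; congr (_ * _).
  by rewrite -big_mkcond/= big_pred1_eq.
rewrite -bigA_distr_bigA (bigD1 i)//= [X in _ * X]big1 ?mulr1; last first.
  by move=> j /negPf ji; rewrite -[RHS](p1 j); apply: eq_bigr => a _; rewrite /q ji mulr1.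
by apply: eq_bigr => a _; rewrite /q eqxx.
Qed.

Definition resample (z : {ffun I -> A}) i a : {ffun I -> A} :=
  [ffun j => if j == i then a else z j].

(* Substitute (a, z) -> (z i, resample z i a), an involution preserving the
   product mass. *)
Lemma sum_resample (p : A -> R) i (G : A -> {ffun I -> A} -> R) :
  \sum_a p a = 1 ->
  \sum_(z : {ffun I -> A}) \prod_j p (z j) * G (z i) z =
  \sum_a p a * \sum_(z : {ffun I -> A}) \prod_j p (z j) * G a (resample z i a).
Proof.
move=> p1; under [RHS]eq_bigr do rewrite big_distrr/=.
pose sw (v : A * {ffun I -> A}) := (v.2 i, resample v.2 i v.1).
have swK : involutive sw.
  case=> a z; rewrite /sw/= ffunE eqxx; congr (_, _).
  by apply/ffunP => j; rewrite !ffunE; case: eqP => [->|].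
rewrite pair_bigA/= (reindex_inj (can_inj swK))/=.
have e (v : A * {ffun I -> A}) : p (v.2 i) * (\prod_j p (resample v.2 i v.1 j) *
    G (v.2 i) (resample (resample v.2 i v.1) i (v.2 i))) =
    p v.1 * (\prod_j p (v.2 j) * G (v.2 i) v.2).
  have -> : resample (resample v.2 i v.1) i (v.2 i) = v.2.
    by apply/ffunP => j; rewrite !ffunE; case: eqP => [->|].
  rewrite (bigD1 i)//= [in RHS](bigD1 i)//= ffunE eqxx.
  have -> : \prod_(j | j != i) p (resample v.2 i v.1 j) = \prod_(j | j != i) p (v.2 j).
    by apply: eq_bigr => j /negPf ji; rewrite ffunE ji.
  ring.
rewrite [RHS](_ : _ = \sum_(v : A * {ffun I -> A})
    p v.1 * (\prod_j p (v.2 j) * G (v.2 i) v.2)); last by apply: eq_bigr => v _; exact: e.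
rewrite -(pair_bigA _ (fun a (z : {ffun I -> A}) => p a * (\prod_j p (z j) * G (z i) z)))/=.
by rewrite exchange_big/=; apply: eq_bigr => z _; rewrite -big_distrl/= p1 mul1r.
Qed.

End Products.

(** * Joint laws generated by a kernel *)

Section Joint.
Context {R : realType} {A B : finType} (P : fdist R A) (K : A -> fdist R B).

Lemma expect_joint (phi : A -> B -> R) :
  expect (joint P K) (fun w => phi w.1 w.2) = \sum_a P a * \sum_b K a b * phi a b.
Proof.
rewrite /expect -(pair_bigA _ (fun a b => P a * K a b * phi a b))/=.
by apply: eq_bigr => a _; rewrite big_distrr/=; apply: eq_bigr => b _; rewrite mulrA.
Qed.

Lemma law_joint_fst (C : finType) (U : A -> C) c :
  law (joint P K) (fun w => U w.1) c = law P U c.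
Proof.
rewrite !law_expect (expect_joint (fun a _ => (U a == c)%:R)).
by apply: eq_bigr => a _; rewrite -big_distrl/= fdist_sum1 mul1r.
Qed.

Lemma law_joint_pair (C : finType) (U : A -> C) c b :
  law (joint P K) (fun w => (U w.1, w.2)) (c, b) = \sum_(a | U a == c) P a * K a b.
Proof.
rewrite law_expect (expect_joint (fun a b' => ((U a, b') == (c, b))%:R)).
rewrite [RHS]big_mkcond; apply: eq_bigr => a _.
rewrite (bigD1 b)//= big1 ?addr0 => [|b' /negPf b'b].
  by rewrite xpair_eqE eqxx andbT; case: eqP; rewrite ?mulr1 ?mulr0.
by rewrite xpair_eqE b'b andbF mulr0.
Qed.

Lemma law_joint_snd b : law (joint P K) (fun w => w.2) b = \sum_a P a * K a b.
Proof.
rewrite law_expect (expect_joint (fun _ b' => (b' == b)%:R)).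
apply: eq_bigr => a _; congr (_ * _).
by rewrite (bigD1 b)//= eqxx mulr1 big1 ?addr0// => b' /negPf->; rewrite mulr0.
Qed.

End Joint.

(** The fibre of [yseq] over [ys] is a product of letter fibres, so the sum of products
    distributes. *)
Lemma law_yseq (R : realType) (X Y : finType) (P : fdist R (X * Y)%type) n
    (ys : {ffun 'I_n -> Y}) :
  law (iid P n) (@yseq X Y n) ys = \prod_i law P (fun u => u.2) (ys i).
Proof.
rewrite /law/= bigA_distr_big_dep; apply: eq_bigl => z.
apply/eqP/familyP => [<- i|h]; first by rewrite ffunE; exact: eqxx.
by apply/ffunP => i; rewrite ffunE; apply/eqP/h.
Qed.

(** * Memoryless encoders, and single-letter kernels of arbitrary encoders *)

Section Encoders.
Context {R : realType} {X Y Xh : finType} (P : fdist R (X * Y)%type).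

Definition memoryless_fun (K : X -> fdist R Xh) n (x : {ffun 'I_n -> X})
  (xh : {ffun 'I_n -> Xh}) : R := \prod_i K (x i) (xh i).

Lemma memoryless_ge0 K n x xh : 0 <= @memoryless_fun K n x xh.
Proof. by apply: prodr_ge0 => i _; exact: fdist_ge0. Qed.

Lemma memoryless_sum1 K n x : \sum_xh @memoryless_fun K n x xh = 1.
Proof.
rewrite -(bigA_distr_bigA (fun i b => K (x i) b)) big1// => i _.
exact: fdist_sum1.
Qed.

Definition memoryless (K : X -> fdist R Xh) n : encoder R X Xh n :=
  fun x => FDist (memoryless_ge0 K x) (memoryless_sum1 K x).

(** Independence of Y and the output, as a factorisation of laws that is linear in [K]. Since [K]
    reads only the first component, the Markov condition is built in. *)
Definition decoupled (K : X -> fdist R Xh) : Prop := forall y b,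
  \sum_(u | u.2 == y) P u * K u.1 b =
  law P (fun u => u.2) y * \sum_u P u * K u.1 b.

Definition kernel_cost (c : X -> Xh -> R) (K : X -> fdist R Xh) : R :=
  expect (joint P (fun u => K u.1)) (fun w => c w.1.1 w.2).

(** The joint law of the two words is a product of single-letter joint laws, each of which
    factors. *)
Lemma memoryless_leakage K n : decoupled K -> leakage P (memoryless K (n := n)) = 0.
Proof.
move=> dK; apply/mutual_info_eq0P => ys xh.
rewrite law_joint_pair law_joint_fst law_joint_snd law_yseq/=.
transitivity (\prod_i \sum_(u | u.2 == ys i) P u * K u.1 (xh i)).
  rewrite bigA_distr_big_dep; apply: eq_big => [z|z _].
    apply/eqP/familyP => [<- i|h]; first by rewrite ffunE; exact: eqxx.
    by apply/ffunP => i; rewrite ffunE; apply/eqP/h.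
  by rewrite -big_split/=; apply: eq_bigr => i _; rewrite ffunE.
under eq_bigr do rewrite dK.
rewrite big_split/=; congr (_ * _); rewrite bigA_distr_bigA.
apply: eq_bigr => z _; rewrite -big_split/=.
by apply: eq_bigr => i _; rewrite ffunE.
Qed.

(** Every letter contributes the single-letter cost. The length is a successor because [n%:R^-1] is
    0 at [n = 0]. *)
Lemma memoryless_cost c K n :
  average_cost P c (memoryless K (n := n.+1)) = kernel_cost c K.
Proof.
rewrite /average_cost /kernel_cost.
rewrite (expect_joint _ _ (fun z xh => additive_cost c (xseq z) xh)).
rewrite (expect_joint _ _ (fun u b => c u.1 b)).
pose phi (u : X * Y) := \sum_b K u.1 b * c u.1 b.
transitivity (\sum_(z : {ffun 'I_n.+1 -> X * Y}) \prod_i P (z i) *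
    (n.+1%:R^-1 * \sum_i phi (z i))).
  apply: eq_bigr => z _; congr (_ * _).
  rewrite [X in X = _](_ : _ = n.+1%:R^-1 * \sum_i \sum_(xh : {ffun 'I_n.+1 -> Xh})
     \prod_j K (z j).1 (xh j) * c (z i).1 (xh i)); last first.
    rewrite exchange_big/= big_distrr/=; apply: eq_bigr => xh _.
    rewrite -big_distrr/= mulrCA /additive_cost; congr (_ * (_ * _)).
      by apply: eq_bigr => j _; rewrite ffunE.
    by apply: eq_bigr => j _; rewrite ffunE.
  congr (_ * _); apply: eq_bigr => i _.
  rewrite (sum_prod_marginal (p := fun j => K (z j).1) i (c (z i).1))//.
  by move=> j; exact: fdist_sum1.
transitivity (n.+1%:R^-1 * \sum_(i < n.+1) \sum_(z : {ffun 'I_n.+1 -> X * Y})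
    \prod_j P (z j) * phi (z i)).
  rewrite exchange_big/= big_distrr/=; apply: eq_bigr => z _.
  by rewrite -big_distrr/= mulrCA.
under eq_bigr => i _.
  rewrite (sum_prod_marginal (p := fun=> P) i phi); first over.
  by move=> _; exact: fdist_sum1.
by rewrite sumr_const card_ord -[X in _ * X]mulr_natl mulKf// pnatr_eq0.
Qed.

(** The source letters are independent, so letter [i] may be redrawn apart from the others;
    averaging over the others leaves a kernel from X. One kernel serves all [phi], so the cost and
    the probes refer to the same joint law. *)
Lemma letter_kernel n (f : encoder R X Xh n) (i : 'I_n) :
  exists K : X -> fdist R Xh, forall phi : X * Y -> Xh -> R,
    expect (encoded P f) (fun w => phi (w.1 i) (w.2 i)) =
    expect (joint P (fun u => K u.1)) (fun w => phi w.1 w.2).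
Proof.
(* Overwriting letter [i] by [x] replaces conditioning on it, so values [x] of probability 0 cause
   no division. *)
pose k x b := \sum_z iid P n z *
  \sum_(xh : {ffun 'I_n -> Xh} | xh i == b) f (resample (xseq z) i x) xh.
have k0 x b : 0 <= k x b.
  apply: sumr_ge0 => z _; apply: mulr_ge0; first exact: fdist_ge0.
  by apply: sumr_ge0 => xh _; exact: fdist_ge0.
have k1 x : \sum_b k x b = 1.
  rewrite /k exchange_big/= -[RHS](fdist_sum1 (iid P n)); apply: eq_bigr => z _.
  rewrite -big_distrr/= -[RHS]mulr1; congr (_ * _).
  rewrite -[RHS](fdist_sum1 (f (resample (xseq z) i x))).
  by rewrite [RHS](partition_big (fun xh : {ffun 'I_n -> Xh} => xh i) xpredT).
exists (fun x => FDist (k0 x) (k1 x)) => phi.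
rewrite (expect_joint _ _ phi) (expect_joint _ _
  (fun (z : {ffun 'I_n -> X * Y}) (xh : {ffun 'I_n -> Xh}) => phi (z i) (xh i)))/=.
rewrite (sum_resample (p := P) i
  (fun u z => \sum_(xh : {ffun 'I_n -> Xh}) f (xseq z) xh * phi u (xh i)));
  last exact: fdist_sum1.
apply: eq_bigr => u _; congr (_ * _).
under [RHS]eq_bigr do rewrite /k big_distrl/=.
rewrite exchange_big/=; apply: eq_bigr => z _.
under [RHS]eq_bigr do rewrite -mulrA.
rewrite -big_distrr/=; congr (_ * _).
(* The encoder sees only [u.1]; this is where the Markov property passes to the single letter. *)
have -> : xseq (resample z i u) = resample (xseq z) i u.1.
  by apply/ffunP => j; rewrite !ffunE; case: ifP.
rewrite (partition_big (fun xh : {ffun 'I_n -> Xh} => xh i) xpredT)//=.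
by apply: eq_bigr => b _; rewrite big_distrl/=; apply: eq_bigr => xh /eqP->.
Qed.

(** All letters share the law [P] and the expectation is linear in the kernel, so the time average
    of the letter kernels works. *)
Lemma average_kernel n (f : encoder R X Xh n.+1) :
  exists K : X -> fdist R Xh, forall phi : X * Y -> Xh -> R,
    \sum_i expect (encoded P f) (fun w => phi (w.1 i) (w.2 i)) =
    n.+1%:R * expect (joint P (fun u => K u.1)) (fun w => phi w.1 w.2).
Proof.
have /boolp.choice[L LP] := letter_kernel f.
pose k x b := n.+1%:R^-1 * \sum_i L i x b.
have k0 x b : 0 <= k x b.
  by rewrite mulr_ge0// sumr_ge0// => i _; exact: fdist_ge0.
have k1 x : \sum_b k x b = 1.
  rewrite -big_distrr/= exchange_big/=; under eq_bigr do rewrite fdist_sum1.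
  by rewrite sumr_const card_ord mulVf// pnatr_eq0.
exists (fun x => FDist (k0 x) (k1 x)) => phi.
under eq_bigr do rewrite LP (expect_joint _ _ phi).
rewrite (expect_joint _ _ phi)/= exchange_big/= big_distrr/=; apply: eq_bigr => u _.
rewrite -big_distrr/= mulrCA; congr (_ * _).
rewrite exchange_big/= big_distrr/=; apply: eq_bigr => b _.
by rewrite -big_distrl/= /k !mulrA mulfV ?pnatr_eq0// mul1r.
Qed.

(** The same probe is placed at every position. The linear gain and the quadratic loss both grow
    like the length, whereas the leakage is counted once, hence its division by [n.+1]. *)
Lemma single_letter_bound n (f : encoder R X Xh n.+1) :
  exists K : X -> fdist R Xh,
    (forall c, kernel_cost c K = average_cost P c f) /\
    (forall y b t, `|t| <= 2^-1 ->
      t * (\sum_(u | u.2 == y) P u * K u.1 b -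
           law P (fun u => u.2) y * \sum_u P u * K u.1 b) <=
      leakage P f / n.+1%:R + 2 * t ^+ 2).
Proof.
have [K KP] := average_kernel f; exists K; split.
  move=> c; have := KP (fun u b => c u.1 b); rewrite /kernel_cost => e.
  rewrite -[LHS](mulKf (_ : n.+1%:R != 0 :> R)) ?pnatr_eq0// -e.
  rewrite /average_cost /expect exchange_big/= big_distrr/=.
  apply: eq_bigr => w _; rewrite -big_distrr/= mulrCA; congr (_ * (_ * _)).
  by apply: eq_bigr => i _; rewrite ffunE.
move=> y b t t2; pose py := law P (fun u => u.2).
have py0 : forall a, 0 <= py a by exact: law_ge0.
have py1 : \sum_a py a = 1 by exact: law_sum1.
pose g (i : 'I_n.+1) (ys : {ffun 'I_n.+1 -> Y}) (xs : {ffun 'I_n.+1 -> Xh}) :=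
  probe py y b t (ys i) (xs i).
have gs i ys xs : `|g i ys xs| <= `|t| by exact: probe_le.
(* The letters of the Y word are independent, so the mean of the product is a product of means, each
   equal to 1. *)
have g1 xs : \sum_ys law (encoded P f) (fun w => yseq w.1) ys *
    \prod_i (1 + g i ys xs) = 1.
  under eq_bigr do rewrite law_joint_fst law_yseq -big_split/=.
  rewrite -(bigA_distr_bigA (fun i a => py a * (1 + probe py y b t a (xs i)))).
  by rewrite big1// => i _; exact: sum_probe.
have := expect_le_mutual_info (fun w => w.2) t2 gs g1.
rewrite -/(leakage P f) real_normK ?num_real//.
have -> : \sum_i expect (encoded P f) (fun w => g i (yseq w.1) w.2) =
    \sum_i expect (encoded P f) (fun w => probe py y b t (w.1 i).2 (w.2 i)).
  by apply: eq_bigr => i _; apply: eq_bigr => w _; rewrite /g ffunE.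
rewrite (KP (fun u => probe py y b t u.2)).
rewrite (expect_probe _ (fun w => w.1.2) (fun w => w.2)).
rewrite law_joint_pair law_joint_snd => h.
rewrite -(ler_pM2l (_ : 0 < n.+1%:R)) ?ltr0n// [leRHS]mulrDr.
by rewrite [_ * (_ / _)]mulrC divfK ?pnatr_eq0.
Qed.

End Encoders.

(** * Limits and compactness *)

Lemma limn_esup_near_le (R : realType) (u : nat -> \bar R) (l : \bar R) :
  (\forall n \near \oo, u n <= l)%E -> (limn_esup u <= l)%E.
Proof.
move=> ul; apply: (@le_trans _ _ (ereal_sup (u @` [set n | u n <= l]%E))).
  by apply: ereal_inf_lbound; exists [set n | u n <= l]%E.
by apply: ge_ereal_sup => _ [n /= h <-].
Qed.

(** The slack [d] makes the inequality strict, so some eventual set already has its supremum below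
    [l + d]. *)
Lemma near_le_limn_esup (R : realType) (u : nat -> \bar R) (l : R) d :
  (limn_esup u <= l%:E)%E -> 0 < d -> \forall n \near \oo, (u n <= (l + d)%:E)%E.
Proof.
move=> ul d0.
have : (limn_esup u < (l + d)%:E)%E.
  by apply: le_lt_trans ul _; rewrite lte_fin ltrDl.
move=> /ereal_inf_lt[_ [V FV <-]] /ltW Vl; apply: filterS FV => n Vn.
by apply: le_trans Vl; apply: ereal_sup_ubound; exists n.
Qed.

(** * Continuity of real-valued functions *)

Section ContinuousReal.
Context {R : realType} {V : topologicalType}.
Implicit Types F G : V -> R.

Lemma continuous_sumr (I : finType) (p : pred I) (H : I -> V -> R) :
  (forall i, continuous (H i)) -> continuous (fun v => \sum_(i | p i) H i v).
Proof. by move=> Hc; apply: continuous_big => // x; exact: add_continuous. Qed.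

Lemma continuous_mull (a : R) F : continuous F -> continuous (fun v => a * F v).
Proof.
move=> Fc v; apply: (@continuous_comp V R R F (fun x => a * x)); first exact: Fc.
exact: mulrl_continuous.
Qed.

Lemma continuous_mulr (a : R) F : continuous F -> continuous (fun v => F v * a).
Proof.
by move=> Fc; rewrite (_ : (fun v => _) = (fun v => a * F v));
  [exact: continuous_mull|apply/funext => v; rewrite mulrC].
Qed.

Lemma continuous_addr F G :
  continuous F -> continuous G -> continuous (fun v => F v + G v).
Proof. by move=> Fc Gc v; apply: (@cvgD R R V); [exact: Fc|exact: Gc]. Qed.

Lemma continuous_subr F G :
  continuous F -> continuous G -> continuous (fun v => F v - G v).
Proof. by move=> Fc Gc v; apply: (@cvgB R R V); [exact: Fc|exact: Gc]. Qed.

Lemma continuous_normr F : continuous F -> continuous (fun v => `|F v|).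
Proof. by move=> Fc v; apply: (@cvg_norm R R); exact: Fc. Qed.

Lemma continuous_maxr F G :
  continuous F -> continuous G -> continuous (fun v => Num.max (F v) (G v)).
Proof. by move=> Fc Gc v; apply: (@continuous_max R V); [exact: Fc|exact: Gc]. Qed.

End ContinuousReal.

(** * Kernels as reproductions, and compactness of the set of kernels *)

Section SingleLetter.
Context {R : realType} {X Y Xh : finType} (P : fdist R (X * Y)%type).

Lemma decoupledP (K : X -> fdist R Xh) :
  decoupled P K <-> mutual_info (joint P (fun u => K u.1))
    (fun w => w.1.2) (fun w => w.2) = 0.
Proof.
rewrite mutual_info_eq0P; split=> h y b; have := h y b;
  by rewrite law_joint_pair (law_joint_fst _ _ (fun u => u.2)) law_joint_snd.
Qed.

Lemma law_id (W : finType) (Q : fdist R W) w : law Q id w = Q w.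
Proof. exact: big_pred1_eq. Qed.

Lemma sum_law_pair (W A B : finType) (Q : fdist R W) (U : W -> A) (V : W -> B) a :
  \sum_b law Q (fun w => (U w, V w)) (a, b) = law Q U a.
Proof.
by rewrite [RHS](partition_big V xpredT)//=; apply: eq_bigr.
Qed.

Lemma kernel_reproduction (K : X -> fdist R Xh) : decoupled P K ->
  independent_reproduction P (joint P (fun u => K u.1)).
Proof.
move=> dK; split.
- by move=> u; rewrite (law_joint_fst _ _ id) law_id.
- move=> y x b.
  rewrite (law_joint_pair _ _ (fun u => (u.2, u.1))).
  rewrite (law_joint_fst _ _ (fun u => (u.2, u.1))).
  rewrite (law_joint_pair _ _ (fun u => u.1)) (law_joint_fst _ _ (fun u => u.1)).
  have -> : \sum_(u | (u.2, u.1) == (y, x)) P u * K u.1 b =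
            law P (fun u => (u.2, u.1)) (y, x) * K x b.
    by rewrite /law big_distrl/=; apply: eq_bigr => u /eqP[_ ->].
  have -> : \sum_(u | u.1 == x) P u * K u.1 b = law P (fun u => u.1) x * K x b.
    by rewrite /law big_distrl/=; apply: eq_bigr => u /eqP->.
  by rewrite -!mulrA [K x b * _]mulrC.
- exact/decoupledP.
Qed.

(** The kernel is the conditional law of the output given X; the Markov identity says that it
    recovers [Q] from [P]. *)
Lemma reproduction_kernel (hXh : (0 < #|Xh|)%N) (Q : fdist R (X * Y * Xh)%type) :
  independent_reproduction P Q ->
  exists2 K : X -> fdist R Xh, decoupled P K & Q = joint P (fun u => K u.1).
Proof.
case=> QP mQ iQ; have /card_gt0P[b0 _] := hXh.
pose pX := law P (fun u => u.1).
have QX x : law Q (fun w => w.1.1) x = pX x.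
  by rewrite (law_comp _ (fun w => w.1) (fun u => u.1)); apply: eq_bigr => u _; rewrite QP.
have PX u : P u <= pX u.1.
  by rewrite /pX /law (bigD1 u)//= lerDl sumr_ge0// => v _; exact: fdist_ge0.
(* At [x] of mass 0 the default is the point mass at [b0], which exists because [Xh] is nonempty. *)
pose k x b := if pX x == 0 then (b == b0)%:R
  else law Q (fun w => (w.1.1, w.2)) (x, b) / pX x.
have k0 x b : 0 <= k x b.
  by rewrite /k; case: ifP => _; rewrite ?ler0n// divr_ge0 ?law_ge0.
have k1 x : \sum_b k x b = 1.
  rewrite /k; case: eqP => [_|/eqP pX0].
    by rewrite (bigD1 b0)//= eqxx big1 ?addr0// => b /negPf->.
  by rewrite -big_distrl/= sum_law_pair QX divff.
have eQ : Q = joint P (fun u => FDist (k0 u.1) (k1 u.1)).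
  apply: fdist_ext => -[[x y] b]/=; rewrite /k.
  case: eqP => [pX0|/eqP pX0].
    have P0 : P (x, y) = 0.
      by apply/eqP; rewrite eq_le fdist_ge0 andbT -pX0; exact: (PX (x, y)).
    apply/eqP; rewrite P0 mul0r eq_le fdist_ge0 andbT -P0 -QP /law.
    by rewrite (bigD1 (x, y, b))//= lerDl sumr_ge0// => v _; exact: fdist_ge0.
  have := mQ y x b; rewrite QX.
  (* The permuted triple and pair are injective recodings, so their laws are the masses
     [Q (x, y, b)] and [P (x, y)]; the positive [pX x] then cancels. *)
  rewrite (law_inj _ id (h := fun w : X * Y * Xh => (w.1.2, w.1.1, w.2)) (x, y, b));
    last by move=> [[? ?] ?] [[? ?] ?] [-> -> ->].
  rewrite (law_inj _ (fun w => w.1) (h := fun u : X * Y => (u.2, u.1)) (x, y));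
    last by move=> [? ?] [? ?] [-> ->].
  by rewrite law_id QP => e; rewrite mulrA -e mulfK.
exists (fun x => FDist (k0 x) (k1 x)) => //.
by apply/decoupledP; rewrite -eQ.
Qed.

(** A continuous penalty attains its minimum on the cube of arrays with entries in [0, 1].
    Approximate solutions push that minimum down to 0, and a zero of the penalty is an exact
    solution. *)
Lemma decoupled_limit (c : X -> Xh -> R) G :
  (forall d, 0 < d -> exists K : X -> fdist R Xh,
    (forall y b, `|\sum_(u | u.2 == y) P u * K u.1 b -
       law P (fun u => u.2) y * \sum_u P u * K u.1 b| <= d) /\
    kernel_cost P c K <= G + d) ->
  exists2 K : X -> fdist R Xh, decoupled P K & kernel_cost P c K <= G.
Proof.
move=> approx; pose V := prod_topology (fun _ : X * Xh => R).
pose def (v : V) y b := \sum_(u | u.2 == y) P u * v (u.1, b) -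
       law P (fun u => u.2) y * \sum_u P u * v (u.1, b).
pose cost (v : V) := \sum_u P u * \sum_b v (u.1, b) * c u.1 b.
(* Three nonnegative penalties: failed normalisation, dependence on Y, and cost above [G].
   Nonnegativity of the entries comes from the cube. *)
pose viol (v : V) := \sum_x `|\sum_b v (x, b) - 1| + \sum_y \sum_b `|def v y b| +
  Num.max (cost v - G) 0.
have projc t : continuous (fun v : V => v t).
  exact: (@proj_continuous _ (fun=> R) t).
have costc : continuous cost.
  apply: continuous_sumr => u; apply: continuous_mull; apply: continuous_sumr => b.
  exact: continuous_mulr.
have defc y b : continuous (def ^~ y ^~ b).
  apply: continuous_subr; first by apply: continuous_sumr => u; exact: continuous_mull.
  by apply: continuous_mull; apply: continuous_sumr => u; exact: continuous_mull.
have violc : continuous viol.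
  apply: continuous_addr; first apply: continuous_addr.
  - apply: continuous_sumr => x; apply: continuous_normr; apply: continuous_subr.
      exact: continuous_sumr.
    exact: cst_continuous.
  - by apply: continuous_sumr => y; apply: continuous_sumr => b; exact: continuous_normr.
  - apply: continuous_maxr; last exact: cst_continuous.
    by apply: continuous_subr => //; exact: cst_continuous.
pose cube := [set v : V | forall t, `[0, 1]%classic (v t)].
have cubeK (K : X -> fdist R Xh) : cube (fun t => K t.1 t.2).
  by move=> t /=; rewrite in_itv/= fdist_ge0 fdist_le1.
have cubec : compact cube.
  apply: (@tychonoff _ (fun _ : X * Xh => R) (fun=> `[0, 1]%classic)) => _.
  exact: segment_compact.
have [K1 _] := approx 1 ltr01.
have cube0 : cube !=set0 by exists (fun t => K1 t.1 t.2).
have [v] := compact_EVT_min cube0 cubec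
  (continuous_subspaceT violc).
rewrite inE => vcube vmin.
(* A genuine kernel has no normalisation penalty; there remain one defect per pair in Y and [Xh] and
   the excess cost, each at most [d]. *)
have viol_le d : 0 < d -> viol v <= (#|Y|%:R * #|Xh|%:R + 1) * d.
  move=> d0; have [K [Kd Kc]] := approx d d0.
  apply: le_trans (vmin _ (mem_set (cubeK K))) _; rewrite /viol/=.
  rewrite big1 ?add0r => [|x _]; last by rewrite fdist_sum1 subrr normr0.
  rewrite mulrDl mul1r; apply: lerD.
    apply: (@le_trans _ _ (\sum_(y : Y) \sum_(b : Xh) d)).
      by apply: ler_sum => y _; apply: ler_sum => b _; exact: Kd.
    by rewrite !sumr_const -mulrnA -[leLHS]mulr_natl mulnC natrM.
  rewrite ge_max; apply/andP; split; last exact: ltW.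
  rewrite lerBlDl.
  by move: Kc; rewrite /kernel_cost (expect_joint _ _ (fun u b => c u.1 b)).
have viol0 : viol v <= 0.
  apply/ler_addgt0Pl => e e0; rewrite addr0.
  have N0 : 0 < #|Y|%:R * #|Xh|%:R + 1 :> R by rewrite ltr_wpDl ?mulr_ge0.
  by have := viol_le (e / _) (divr_gt0 e0 N0); rewrite mulrC divfK ?gt_eqF.
have s1 : 0 <= \sum_x `|\sum_b v (x, b) - 1| by exact: sumr_ge0.
have s2 : 0 <= \sum_y \sum_b `|def v y b|.
  by apply: sumr_ge0 => y _; exact: sumr_ge0.
have s3 : 0 <= Num.max (cost v - G) 0 by rewrite le_max lexx orbT.
have {s1 s2 s3 viol0} [s1 s2 s3] : [/\ \sum_x `|\sum_b v (x, b) - 1| = 0,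
    \sum_y \sum_b `|def v y b| = 0 & Num.max (cost v - G) 0 <= 0].
  by move: viol0 s1 s2 s3; rewrite /viol; split; lra.
have k0 x b : 0 <= v (x, b) by have := vcube (x, b); rewrite /= in_itv/= => /andP[].
have k1 x : \sum_b v (x, b) = 1.
  have /psumr_eq0P := s1; move=> /(_ (fun _ _ => normr_ge0 _)) /(_ x isT).
  by move/eqP; rewrite normr_eq0 subr_eq0 => /eqP.
exists (fun x => FDist (k0 x) (k1 x)) => [y b|].
  have /psumr_eq0P := s2; move=> /(_ (fun _ _ => sumr_ge0 _ (fun _ _ => normr_ge0 _))).
  move=> /(_ y isT) sy; have := psumr_eq0P (fun b _ => normr_ge0 (def v y b)) sy.
  by move=> /(_ b isT) /eqP; rewrite normr_eq0 subr_eq0 => /eqP.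
rewrite /kernel_cost (expect_joint _ _ (fun u b => c u.1 b)).
by move: s3; rewrite ge_max subr_le0 => /andP[].
Qed.

End SingleLetter.

(** * The operational cost *)

Section OperationalCost.
Context {R : realType} {X Y Xh : finType} (P : fdist R (X * Y)%type).
Context (c : X -> Xh -> R) (c_ge0 : forall x xh, 0 <= c x xh).

Lemma kernel_cost_ge0 (K : X -> fdist R Xh) : 0 <= kernel_cost P c K.
Proof. by apply: sumr_ge0 => w _; apply: mulr_ge0 => //; exact: fdist_ge0. Qed.

Lemma single_letter_costsE (hXh : (0 < #|Xh|)%N) :
  single_letter_costs P c = [set kernel_cost P c K | K in decoupled P (Xh := Xh)].
Proof.
apply/seteqP; split=> a [].
  move=> Q iQ <-; have [K dK ->] := reproduction_kernel hXh iQ.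
  by exists K.
by move=> K dK <-; exists (joint P (fun u => K u.1)); first exact: kernel_reproduction.
Qed.

(** A constant output is independent of Y. *)
Lemma decoupled_exists (hXh : (0 < #|Xh|)%N) : exists K : X -> fdist R Xh, decoupled P K.
Proof.
have /card_gt0P[b0 _] := hXh; pose k (b : Xh) : R := (b == b0)%:R.
have k0 b : 0 <= k b by exact: ler0n.
have k1 : \sum_b k b = 1.
  by rewrite (bigD1 b0)//= /k eqxx big1 ?addr0// => b /negPf->.
exists (fun=> FDist k0 k1) => y b.
by rewrite -!big_distrl/= fdist_sum1 mul1r.
Qed.

(** Decoupled kernels with cost close to the infimum exist, and [decoupled_limit] at the infimum
    yields one that attains it. *)
Lemma decoupled_minimum (hXh : (0 < #|Xh|)%N) :
  exists2 K : X -> fdist R Xh, decoupled P K &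
    forall L : X -> fdist R Xh, decoupled P L -> kernel_cost P c K <= kernel_cost P c L.
Proof.
pose S := [set kernel_cost P c K | K in decoupled P (Xh := Xh)].
have S0 : lbound S 0 by move=> _ [K _ <-]; exact: kernel_cost_ge0.
have Sinf : has_inf S.
  have [K dK] := decoupled_exists hXh.
  by split; [exists (kernel_cost P c K), K|exists 0].
have [d d0|K dK Kinf] := @decoupled_limit R X Y Xh P c (inf S).
  have [_ [K dK <-] /ltW Kd] := inf_adherent d0 Sinf.
  by exists K; split=> // y b; rewrite dK subrr normr0 ltW.
exists K => // L dL; apply: le_trans Kinf _.
by apply: ge_inf; [exists 0|exists L].
Qed.

Lemma memoryless_achievable (K : X -> fdist R Xh) eps : 0 <= eps -> decoupled P K ->
  strongly_achievable P c eps (kernel_cost P c K).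
Proof.
move=> eps0 dK; exists (memoryless K); split; apply: limn_esup_near_le.
  by apply: nearW => n; rewrite lee_fin memoryless_leakage.
(* Index 0 is skipped, as the cost identity is stated for positive lengths. *)
by exists 1%N => // -[|n]//= _; rewrite lee_fin memoryless_cost.
Qed.

(** For each tolerance [d], a fixed small probe and then a long block give a kernel with defects at
    most [d] and cost at most [G + d]; compactness concludes. *)
Lemma achievable_decoupled eps G : 0 <= eps -> strongly_achievable P c eps G ->
  exists2 K : X -> fdist R Xh, decoupled P K & kernel_cost P c K <= G.
Proof.
move=> eps0 [f [leak cost]]; apply: decoupled_limit => d d0.
(* The probe bound requires [s <= 2^-1], and [s <= d / 4] makes the quadratic error at most
   [s * d / 2]. *)
pose s := Num.min 2^-1 (d / 4).
have s0 : 0 < s by rewrite lt_min; apply/andP; split; lra.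
have s2 : s <= 2^-1 by rewrite ge_min lexx.
have sd : s <= d / 4 by rewrite ge_min lexx orbT.
(* Eventually the leakage is at most [eps + 1]; once [n.+1%:R^-1] is below this threshold, leakage
   per letter is at most [s * d / 2]. *)
have e0 : 0 < s * d / 2 / (eps + 1).
  by apply: divr_gt0; [rewrite !(divr_gt0, mulr_gt0)|lra].
have := near_infty_natSinv_lt (PosNum e0).
have := filterI (near_le_limn_esup leak ltr01) (near_le_limn_esup cost d0).
move=> [N1 _ h1] [N2 _ h2]; pose n := maxn N1 N2.
(* The block length is [n.+1], while the inverse bound is indexed by [n]. *)
have [] := h1 n.+1 (leqW (leq_maxl _ _)); rewrite /= !lee_fin => leakn costn.
have {}h2 : n.+1%:R^-1 < s * d / 2 / (eps + 1) := h2 n (leq_maxr _ _).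
have [K [Kc Kd]] := single_letter_bound P (f n.+1).
exists K; split=> [y b|]; last by rewrite Kc.
have leaks : leakage P (f n.+1) / n.+1%:R <= s * d / 2.
  apply: (@le_trans _ _ ((eps + 1) / n.+1%:R)).
    by rewrite ler_wpM2r ?invr_ge0.
  by rewrite mulrC -ler_pdivlMr; [exact: ltW|lra].
have ss : 2 * s ^+ 2 <= s * d / 2.
  by have := ler_wpM2l (ltW s0) sd; rewrite expr2; lra.
have Ks t : `|t| = s -> t * (\sum_(u | u.2 == y) P u * K u.1 b -
    law P (fun u => u.2) y * \sum_u P u * K u.1 b) <= s * d.
  move=> ts; have := Kd y b t; rewrite ts => /(_ s2).
  rewrite -(real_normK (num_real t)) ts => /le_trans; apply.
  by rewrite [leRHS]splitr lerD.
(* The probes [t = - s] and [t = s] bound the defect from below and from above. *)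
rewrite ler_norml; apply/andP; split; rewrite -(ler_pM2l s0).
  by rewrite mulrN lerNl -mulNr; apply: Ks; rewrite normrN gtr0_norm.
by apply: Ks; rewrite gtr0_norm.
Qed.

End OperationalCost.

Unset Implicit Arguments.

Theorem theorem4 (R : realType) (X Y Xh : finType) (hXh : (0 < #|Xh|)%N)
    (P : fdist R (X * Y)%type)
    (c : X -> Xh -> R) (hc : forall x xh, 0 <= c x xh)
    (eps : R) (heps : 0 <= eps) :
  exists2 m : R, is_minimum (single_letter_costs P c) m
               & min_average_cost P c eps = m%:E.
Proof.
have [K dK Kmin] := decoupled_minimum P hc hXh.
exists (kernel_cost P c K).
  rewrite single_letter_costsE//; split; first by exists K.
  by move=> _ [L dL <-]; exact: Kmin.
apply/eqP; rewrite eq_le; apply/andP; split.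
  apply: ereal_inf_lbound; exists (kernel_cost P c K) => //.
  by split; [exact: kernel_cost_ge0|exact: memoryless_achievable].
(* Each achievable [G] dominates the cost of some decoupled kernel, hence the minimum. *)
apply: le_ereal_inf_tmp => _ [G [_ GA] <-]; rewrite lee_fin.
have [L dL] := achievable_decoupled heps GA.
exact: le_trans (Kmin L dL).
Qed.
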